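(* Let $L,T,\rho,g,v>0$ and $\Lambda>1$ be real numbers, let $N_x\ge 2$ and $N_z\ge 1$ be integers, and let $V^h$ be the associated $Q^1$ finite element space. (i) If $R^\Lambda$ is defined by the integral formula $$R^\Lambda(v,f)=\frac{4\rho g v}{\pi}\int_1^\Lambda|T_f(v,\lambda)|^2\frac{\lambda^2}{\sqrt{\lambda^2-1}}\,d\lambda,$$ then there exists a linear subspace $W^h\subset V^h$ of dimension greater than or equal to $\max\{N_x,N_z\}-1$ such that $R^\Lambda(v,f)>0$ for all $f\in W^h\setminus\{0\}$. (ii) The same holds for numerical integration with sufficiently small maximum stepsize: there exists $\delta>0$ such that, for every integer $K^\star\ge1$, all nodes $1\le\lambda_1<\cdots<\lambda_{K^\star}\le\Lambda$ with $\delta\lambda_{max}<\delta$, and all weights $\omega_1,\dots,\omega_{K^\star}>0$, if $R^\Lambda$ is defined by $$R^\Lambda(v,f)=\frac{4\rho g v}{\pi}\sum_{j=1}^{K^\star}\omega_j|T_f(v,\lambda_j)|^2,$$ then there exists a linear subspace $W^h\subset V^h$ of dimension greater than or equal to $\max\{N_x,N_z\}-1$ such that $R^\Lambda(v,f)>0$ for all $f\in W^h\setminus\{0\}$.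
   Context: Let $\Omega=(-L/2,L/2)\times(0,T)$, with points written $(x,z)$. For a real-valued $f\in H^1(\Omega)$, $v>0$ and $\lambda\in\mathbb{R}$, set $$T_f(v,\lambda)=\int_{-L/2}^{L/2}\int_0^T\partial_xf(x,z)\,e^{-\lambda^2vz}e^{-i\lambda vx}\,dz\,dx .$$ Finite element space: put $\delta x=L/N_x$, $\delta z=T/N_z$ and divide $\Omega$ into $N_x\times N_z$ rectangles of size $\delta x\times\delta z$ by the Cartesian grid with nodes $(-L/2+k\,\delta x,\ l\,\delta z)$, $0\le k\le N_x$, $0\le l\le N_z$. Let $\hat\varphi(s)=\max(1-|s|,0)$ for $s\in\mathbb{R}$. To a node $(x_i,z_i)$ associate the hat-function (restricted to $\Omega$) $$e_i(x,z)=\hat\varphi\Big(\frac{x-x_i}{\delta x}\Big)\hat\varphi\Big(\frac{z-z_i}{\delta z}\Big).$$ $V^h$ is the real vector space spanned by the hat-functions of the interior nodes and of the nodes with $z_i=0$ and $x_i\in(-L/2,L/2)$. So functions in $V^h$ vanish on $x=\pm L/2$ and on $z=T$, and $\dim V^h=(N_x-1)N_z$. Maximum stepsize: for nodes $1\le\lambda_1<\cdots<\lambda_{K^\star}\le\Lambda$, set $\lambda_0=1$, $\lambda_{K^\star+1}=\Lambda$ and $\delta\lambda_{max}=\max_{0\le k\le K^\star}(\lambda_{k+1}-\lambda_k)$. *)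

(* Defs.v *)
From HB Require Import structures.
From mathcomp Require Import all_boot all_order all_algebra.
From mathcomp Require Import complex.
From mathcomp Require Import all_classical all_reals all_analysis.
Set Implicit Arguments.
Unset Strict Implicit.
Unset Printing Implicit Defensive.
Import Order.TTheory GRing.Theory Num.Theory.
Import numFieldNormedType.Exports.
Local Open Scope classical_set_scope.
Local Open Scope complex_scope.
Local Open Scope ring_scope.

Section LinearAlgebra.
Variables (R : realType) (V : lmodType R).

Definition linear_subspace (W : set V) : Prop :=
  W 0 /\ forall (a : R) (f g : V), W f -> W g -> W (a *: f + g).

Definition linear_span (B : set V) : set V :=
  [set f | exists (n : nat) (c : 'I_n -> R) (b : 'I_n -> V),
     (forall i, B (b i)) /\ f = \sum_(i < n) c i *: b i].

Definition linearly_independent (n : nat) (b : 'I_n -> V) : Prop :=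
  forall c : 'I_n -> R, \sum_(i < n) c i *: b i = 0 -> forall i, c i = 0.

Definition has_dimension (W : set V) (n : nat) : Prop :=
  exists b : 'I_n -> V, linearly_independent b /\ W = linear_span (range b).

End LinearAlgebra.

(* Functions on Omega are represented by their extension by 0 to the plane;
   the regular module R^o makes R * R -> R^o a vector space over R. *)
Definition plane_fun (R : realType) : lmodType R := (R * R)%type -> R^o.

Section FiniteElements.
Variables (R : realType) (L T : R) (Nx Nz : nat).

Definition Omega : set (R * R) := `]- (L / 2), (L / 2)[ `*` `]0, T[.

Definition deltax : R := L / Nx%:R.
Definition deltaz : R := T / Nz%:R.

Definition node (k l : nat) : R * R := (- (L / 2) + k%:R * deltax, l%:R * deltaz).

Definition phihat (s : R) : R := Num.max (1 - `|s|) 0.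

Definition hat (p : R * R) : plane_fun R := fun q =>
  phihat ((q.1 - p.1) / deltax) * phihat ((q.2 - p.2) / deltaz) * \1_Omega q.

Definition interior_node (k l : nat) : Prop := (0 < k < Nx)%N /\ (0 < l < Nz)%N.

Definition surface_node (k l : nat) : Prop := (0 < k < Nx)%N /\ l = 0%N.

Definition Vh : set (plane_fun R) :=
  linear_span [set f | exists k l : nat,
    (interior_node k l \/ surface_node k l) /\ f = hat (node k l)].

End FiniteElements.

Section WaveResistance.
Variable R : realType.

(* e^{i t} for real t *)
Definition expi (t : R) : R[i] := cos t +i* sin t.

(* Lebesgue integral of a complex-valued function of one real variable *)
Definition Cintegral (D : set R) (F : R -> R[i]) : R[i] :=
  (\int[lebesgue_measure]_(x in D) complex.Re (F x))
  +i* (\int[lebesgue_measure]_(x in D) complex.Im (F x)).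

(* Classical partial derivative. An element of Vh is continuous and piecewise
   bilinear on Omega: there this derivative exists off finitely many vertical
   lines and equals the weak derivative of f in H^1 almost everywhere. *)
Definition partial_x (f : plane_fun R) (x z : R) : R :=
  derive1 (fun s : R => f (s, z)) x.

Definition Tf (L T : R) (f : plane_fun R) (v lam : R) : R[i] :=
  Cintegral `]- (L / 2), (L / 2)[ (fun x => Cintegral `]0, T[ (fun z =>
    (partial_x f x z)%:C * (expR (- (lam ^+ 2 * v * z)))%:C
    * expi (- (lam * v * x)))).

Definition R_integral (L T rho g Lambda v : R) (f : plane_fun R) : R :=
  4 * rho * g * v / pi *
  \int[lebesgue_measure]_(lam in `]1, Lambda[)
     (Normc.normc (Tf L T f v lam) ^+ 2 * (lam ^+ 2 / Num.sqrt (lam ^+ 2 - 1))).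

(* The nodes and weights are those of index 1, ..., K. *)
Definition R_quadrature (L T rho g : R) (K : nat) (lam w : nat -> R) (v : R)
    (f : plane_fun R) : R :=
  4 * rho * g * v / pi *
  \sum_(1 <= j < K.+1) w j * Normc.normc (Tf L T f v (lam j)) ^+ 2.

Definition quadrature_nodes (Lambda : R) (K : nat) (lam : nat -> R) : Prop :=
  [/\ 1 <= lam 1%N,
      forall j : nat, (1 <= j < K)%N -> lam j < lam j.+1 &
      lam K <= Lambda].

(* Extension by the endpoints: lambda_0 = 1 and lambda_{K+1} = Lambda. *)
Definition extended_node (Lambda : R) (K : nat) (lam : nat -> R) (k : nat) : R :=
  if k == 0%N then 1 else if k == K.+1 then Lambda else lam k.

(* The differences are nonnegative for admissible nodes, so that 0 is a
   neutral default value of the maximum. *)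
Definition max_stepsize (Lambda : R) (K : nat) (lam : nat -> R) : R :=
  \big[Num.max/0]_(k < K.+1)
    (extended_node Lambda K lam k.+1 - extended_node Lambda K lam k).

End WaveResistance.

(* Main.v *)
(** On a tensor function [Phi(x) Psi(z)] the transform T splits into an
    x-integral and a z-integral.  Integrating a hat function over the cells of
    the grid, the k-th hat in x contributes, up to a factor that does not depend
    on k, the k-th power of [exp (- i lam v deltax)], and for l > 0 the l-th hat
    in z contributes the l-th power of [exp (- lam^2 v deltaz)].  Hence on the
    span of the hats of one horizontal, respectively one vertical, grid line,
    [T_f(v, lam)] is a common factor times a polynomial in a quantity that is
    injective in lam near [lam = 1], the degree being less than the dimension.
    A nonzero f thus has fewer zeros of T than the dimension in a fixed interval
    [(1, beta)]: they form a null set, and fine quadrature nodes cannot all be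
    zeros. *)
Require Import Defs.
From HB Require Import structures.
From mathcomp Require Import all_boot all_order all_algebra.
From mathcomp Require Import complex.
From mathcomp Require Import all_classical all_reals all_analysis.
From mathcomp Require Import measurable_realfun.
From mathcomp Require Import ring lra zify.
Import Order.TTheory GRing.Theory Num.Theory.
Import numFieldNormedType.Exports.
Local Open Scope classical_set_scope.
Local Open Scope ring_scope.

Set Implicit Arguments.
Unset Strict Implicit.
Unset Printing Implicit Defensive.

(** * Integrals of piecewise continuous functions *)

Lemma integrable_continuous_oo (R : realType) (a b : R) (g : R -> R) :
  continuous g -> (@lebesgue_measure R).-integrable `]a, b[ (EFin \o g).
Proof.
move=> cg; have : (@lebesgue_measure R).-integrable `[a, b] (EFin \o g).
  apply: continuous_compact_integrable; first exact: segment_compact.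
  exact: continuous_subspaceT.
by apply: integrableS => //; exact: subset_itv_oo_cc.
Qed.

Lemma Rintegral_sum (R : realType) (D : set R) (I : Type) (s : seq I)
    (F : I -> R -> R) : measurable D ->
  (forall i, (@lebesgue_measure R).-integrable D (EFin \o F i)) ->
  (@lebesgue_measure R).-integrable D (EFin \o (fun x => \sum_(i <- s) F i x)) /\
  \int[lebesgue_measure]_(x in D) (\sum_(i <- s) F i x) =
  \sum_(i <- s) \int[lebesgue_measure]_(x in D) F i x.
Proof.
move=> mD iF; elim: s => [|i s [IH1 IH2]].
  rewrite big_nil; split.
    rewrite (_ : _ \o _ = cst 0%E) ?integrable0//.
    by apply/funext => x /=; rewrite big_nil.
  under eq_Rintegral do rewrite big_nil.
  by rewrite Rintegral_cst// mul0r.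
split.
  rewrite (_ : _ \o _ = (EFin \o F i) \+ (EFin \o (fun x => \sum_(i <- s) F i x)%R))%E.
    exact: integrableD.
  by apply/funext => x /=; rewrite big_cons EFinD.
under eq_Rintegral do rewrite big_cons.
by rewrite RintegralD// big_cons IH2.
Qed.

Lemma piece_Rintegral (R : realType) (a b p q : R) (g : R -> R) :
  a <= p -> q <= b -> continuous g ->
  (@lebesgue_measure R).-integrable `]a, b[ (EFin \o (fun x => g x * \1_`]p, q[ x)) /\
  \int[lebesgue_measure]_(x in `]a, b[) (g x * \1_`]p, q[ x) =
  \int[lebesgue_measure]_(x in `[p, q]) g x.
Proof.
move=> ap qb cg.
have E : (fun x => g x * \1_`]p, q[ x) = g \_ `]p, q[.
  by apply/funext => x; rewrite patchE indicE; case: ifPn; rewrite (mulr1, mulr0).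
have S : `]a, b[%classic `&` `]p, q[%classic = `]p, q[%classic :> set R.
  by apply/setIidPr; apply: subset_itv; rewrite bnd_simp.
rewrite E; split.
  rewrite -restrict_EFin; apply/integrable_restrict => //=.
  rewrite S; exact: integrable_continuous_oo.
rewrite -Rintegral_mkcondr S /Rintegral; congr fine.
by rewrite [RHS]integral_itv_bndoo//; case/integrableP: (integrable_continuous_oo p q cg).
Qed.

(** Equality off a countable set is what the applications offer: slopes and half-cell formulas of
    hat functions hold only away from the kinks. Measurability of [f] is derived: off [N] it agrees
    with the finite sum [G] of truncated continuous functions, and every subset of a countable set
    is measurable. Such a set is also null, so the two integrals agree. *)
Lemma Rintegral_piecewise (R : realType) (a b : R) (I : finType)
    (p q : I -> R) (g : I -> R -> R) (f : R -> R) (N : set R) :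
  countable N -> (forall i, a <= p i) -> (forall i, q i <= b) ->
  (forall i, continuous (g i)) ->
  (forall x, a < x < b -> ~ N x ->
     f x = \sum_i g i x * \1_`]p i, q i[ x) ->
  (@lebesgue_measure R).-integrable `]a, b[ (EFin \o f) /\
  \int[lebesgue_measure]_(x in `]a, b[) f x =
  \sum_i \int[lebesgue_measure]_(x in `[p i, q i]) g i x.
Proof.
move=> cN ap qb cg fE.
pose G x := \sum_i g i x * \1_`]p i, q i[ x.
have [iG GE] : (@lebesgue_measure R).-integrable `]a, b[ (EFin \o G) /\
  \int[lebesgue_measure]_(x in `]a, b[) G x =
  \sum_i \int[lebesgue_measure]_(x in `[p i, q i]) g i x.
  have [|//|? ->] := @Rintegral_sum R `]a, b[%classic I (index_enum I)
    (fun i x => g i x * \1_`]p i, q i[ x); first by [].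
    by move=> i; case: (piece_Rintegral (ap i) (qb i) (cg i)).
  split=> //; apply: eq_bigr => i _.
  by case: (piece_Rintegral (ap i) (qb i) (cg i)).
pose M := `]a, b[%classic `&` N.
have cM : countable M by apply: (sub_countable _ cN); apply: subset_card_le => x [].
have mM : measurable M by exact: countable_measurable.
have mG : measurable_fun `]a, b[%classic G by apply/measurable_EFinP; case/integrableP: iG.
have Gf : {in `]a, b[%classic `\` M, G =1 f}.
  move=> x /set_mem[xab Mx] /=; rewrite fE// => Nx.
  by apply: Mx; split.
have mf : measurable_fun `]a, b[%classic f.
  have -> : `]a, b[%classic = (`]a, b[%classic `\` M) `|` M.
    by rewrite setUC setDUK//; exact: subIsetl.
  apply/measurable_funU => //; first exact: measurableD.
  split.
    apply: eq_measurable_fun Gf _.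
    by apply: measurable_funS mG => //; exact: subDsetl.
  move=> _ B mB; apply: countable_measurable => //.
  by apply: (sub_countable _ cM); apply: subset_card_le => x [].
have M0 : (@lebesgue_measure R) M = 0%E by exact: countable_lebesgue_measure0.
have iGf : (@lebesgue_measure R).-integrable `]a, b[ (EFin \o f).
  apply: (proj2 (@negligible_integrable _ _ _ lebesgue_measure `]a, b[%classic M
    (EFin \o f) mM _ _ M0)) => //.
    exact/measurable_EFinP.
  apply: (@eq_integrable _ _ _ lebesgue_measure (`]a, b[%classic `\` M) _
    (EFin \o G)); first exact: measurableD.
    by move=> x xD; rewrite /= Gf.
  by apply: integrableS iG => //; exact: measurableD.
split=> //; rewrite -GE /Rintegral; congr fine.
have drop h : (@lebesgue_measure R).-integrable `]a, b[ h ->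
    (\int[lebesgue_measure]_(x in `]a, b[) h x =
     \int[lebesgue_measure]_(x in `]a, b[%classic `\` M) h x)%E.
  by move=> ih; apply: (@negligible_integral _ _ _ lebesgue_measure).
rewrite (drop (EFin \o f))// (drop (EFin \o G))//.
by apply: eq_integral => x xD; rewrite /= Gf.
Qed.

(** * Explicit antiderivatives *)

Lemma Rintegral_FTC2 (R : realType) (F f : R -> R) (a b : R) : a < b ->
  continuous f -> (forall x, is_derive x (1 : R) F (f x)) ->
  \int[lebesgue_measure]_(x in `[a, b]) f x = F b - F a.
Proof.
move=> ab cf dF; rewrite /Rintegral (@continuous_FTC2 _ f F)//=.
- exact: continuous_subspaceT.
- have cF x : {for x, continuous F}.
    by apply/differentiable_continuous/derivable1_diffP; case: (dF x).
  split; first by move=> x _; case: (dF x).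
    exact/cvg_at_right_filter/cF.
  exact/cvg_at_left_filter/cF.
- by move=> x _; rewrite derive1E; case: (dF x).
Qed.

Lemma Rintegral_cosM (R : realType) (a p q : R) : a != 0 -> p < q ->
  \int[lebesgue_measure]_(x in `[p, q]) cos (a * x) = (sin (a * q) - sin (a * p)) / a.
Proof.
move=> a0 pq; have dF x : is_derive x (1 : R) (fun x => sin (a * x) / a) (cos (a * x)).
  apply: is_derive_eq.
  by rewrite /GRing.scale/=; field.
rewrite (Rintegral_FTC2 pq _ dF)//; first by rewrite mulrBl.
move=> x; apply: continuous_comp; last exact: continuous_cos.
exact: mulrl_continuous.
Qed.

Lemma Rintegral_sinM (R : realType) (a p q : R) : a != 0 -> p < q ->
  \int[lebesgue_measure]_(x in `[p, q]) sin (a * x) = (cos (a * p) - cos (a * q)) / a.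
Proof.
move=> a0 pq; have dF x : is_derive x (1 : R) (fun x => - cos (a * x) / a) (sin (a * x)).
  apply: is_derive_eq.
  by rewrite /GRing.scale/=; field.
rewrite (Rintegral_FTC2 pq _ dF)//; first by rewrite -mulrBl opprK addrC.
move=> x; apply: continuous_comp; last exact: continuous_sin.
exact: mulrl_continuous.
Qed.

Lemma continuous_affine_exp (R : realType) (s al be : R) :
  continuous (fun z => (al + be * z) * expR (- (s * z))).
Proof.
move=> z; apply: cvgM.
  by apply: cvgD; [exact: cvg_cst|exact: mulrl_continuous].
apply: continuous_comp; last exact: continuous_expR.
by apply: cvgN; exact: mulrl_continuous.
Qed.

Lemma Rintegral_affine_exp (R : realType) (s al be p q : R) : s != 0 -> p < q ->
  \int[lebesgue_measure]_(z in `[p, q]) ((al + be * z) * expR (- (s * z))) =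
  ((al + be * p) / s + be / s ^+ 2) * expR (- (s * p)) -
  ((al + be * q) / s + be / s ^+ 2) * expR (- (s * q)).
Proof.
move=> s0 pq.
have dF z : is_derive z (1 : R)
    (fun z => - (((al + be * z) / s + be / s ^+ 2) * expR (- (s * z))))
    ((al + be * z) * expR (- (s * z))).
  apply: is_derive_eq; rewrite /GRing.scale/=; field.
  by rewrite s0.
rewrite (Rintegral_FTC2 pq _ dF)//; first by rewrite opprK addrC.
exact: continuous_affine_exp.
Qed.

(** * Hat functions of one variable and their integrals *)

(** At [x = c] both indicators of open cells vanish while the hat equals 1, hence the condition
    [x != c]. At the outer kinks both sides are 0. *)
Lemma phihatE (R : realType) (c d x : R) : 0 < d -> x != c ->
  phihat ((x - c) / d) =
  (1 + (x - c) / d) * \1_`]c - d, c[ x + (1 - (x - c) / d) * \1_`]c, c + d[ x.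
Proof.
move=> d0 xc; rewrite !indicE /phihat.
have dE : x - c = ((x - c) / d) * d by rewrite divfK ?gt_eqF.
set t := (x - c) / d in dE *.
have -> : (x \in `]c - d, c[%classic) = (-1 < t < 0).
  by apply/idP/idP; rewrite inE /= in_itv /= => /andP[? ?]; apply/andP; split; nra.
have -> : (x \in `]c, c + d[%classic) = (0 < t < 1).
  by apply/idP/idP; rewrite inE /= in_itv /= => /andP[? ?]; apply/andP; split; nra.
have t0 : t != 0 by apply: contra_neq xc => t0; rewrite t0 mul0r in dE; lra.
have [t0'|t0'|t00] := ltgtP t 0; last by rewrite t00 eqxx in t0.
- rewrite andbT /= mulr0 addr0 ltr0_norm//.
  have [t1|t1] := ltP (-1) t; rewrite ?(mulr1, mulr0).
    by rewrite maxEle; case: ifPn; lra.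
  by rewrite maxEle; case: ifPn; lra.
- rewrite andbF /= mulr0 add0r gtr0_norm//.
  have [t1|t1] := ltP t 1; rewrite ?(mulr1, mulr0).
    by rewrite maxEle; case: ifPn; lra.
  by rewrite maxEle; case: ifPn; lra.
Qed.

Lemma is_derive_phihat (R : realType) (c d x : R) : 0 < d ->
  x != c - d -> x != c -> x != c + d ->
  is_derive x (1 : R) (fun s => phihat ((s - c) / d) : R)
    ((\1_`]c - d, c[ x - \1_`]c, c + d[ x) / d).
Proof.
move=> d0 x1 x2 x3.
(* The three kinks cut the line into four open intervals [J], on each of which the hat is affine in
   [(s - c) / d]; its slope [B] is 0, 1, -1, 0 from left to right. *)
have near_affine (A B : R) (J : set R) : open J -> J x ->
    (forall s, J s -> s != c /\ phihat ((s - c) / d) = A + B * ((s - c) / d)) ->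
    is_derive x (1 : R) (fun s => phihat ((s - c) / d) : R) (B / d).
  move=> oJ Jx JE.
  apply: (@near_eq_is_derive _ _ _ (fun s : R => A + B * ((s - c) / d))).
    by near=> s; apply/esym; apply: (JE s _).2; near: s; exact: open_nbhs_nbhs.
  apply: is_derive_eq; rewrite /GRing.scale/=; field.
  by rewrite gt_eqF.
have E (s : R) (J1 J2 : bool) : s != c ->
    (s \in `]c - d, c[) = J1 -> (s \in `]c, c + d[) = J2 ->
    phihat ((s - c) / d) = (1 + (s - c) / d) * J1%:R + (1 - (s - c) / d) * J2%:R.
  move=> sc E1 E2; rewrite phihatE// !indicE -E1 -E2; congr (_ * _%:R + _ * _%:R).
    by rewrite mem_setE.
  by rewrite mem_setE.
have F (s : R) (J1 J2 : bool) :
    (s \in `]c - d, c[) = J1 -> (s \in `]c, c + d[) = J2 ->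
    \1_`]c - d, c[ s - \1_`]c, c + d[ s = J1%:R - J2%:R :> R.
  by move=> <- <-; rewrite !indicE !mem_setE.
have [xl|xl|xl] := ltgtP x (c - d); last by rewrite xl eqxx in x1.
- rewrite (F _ false false); [|by rewrite in_itv/=; lra..].
  rewrite subrr; apply: (near_affine 0 0 `]-oo, c - d[%classic); first exact: interval_open.
    by rewrite /= in_itv.
  move=> s /=; rewrite in_itv /= => sl; split; first by lra.
  by rewrite (E _ false false); [rewrite /=; ring|rewrite ?in_itv/=; lra..].
have [xc|xc|xc] := ltgtP x c; last by rewrite xc eqxx in x2.
- rewrite (F _ true false); [|by rewrite in_itv/=; lra..].
  rewrite subr0; apply: (near_affine 1 1 `]c - d, c[%classic); first exact: interval_open.
    by rewrite /= in_itv/= xl.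
  move=> s /=; rewrite in_itv /= => sl; split; first by lra.
  by rewrite (E _ true false); [rewrite /=; ring|rewrite ?in_itv/=; lra..].
have [xr|xr|xr] := ltgtP x (c + d); last by rewrite xr eqxx in x3.
- rewrite (F _ false true); [|by rewrite in_itv/=; lra..].
  rewrite sub0r; apply: (near_affine 1 (-1) `]c, c + d[%classic); first exact: interval_open.
    by rewrite /= in_itv/= xr xc.
  move=> s /=; rewrite in_itv /= => sl; split; first by lra.
  by rewrite (E _ false true); [rewrite /=; ring|rewrite ?in_itv/=; lra..].
- rewrite (F _ false false); [|by rewrite in_itv/=; lra..].
  rewrite subrr; apply: (near_affine 0 0 `]c + d, +oo[%classic); first exact: interval_open.
    by rewrite /= in_itv/= xr.
  move=> s /=; rewrite in_itv /= andbT => sl; split; first by lra.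
  by rewrite (E _ false false); [rewrite /=; ring|rewrite ?in_itv/=; lra..].
Unshelve. all: by end_near. Qed.

(* Value of the integral over [(0, T)] of [exp (- s z)] times the hat of half
   width [d] centred at [c]; only half of the hat lies in [(0, T)] if [c = 0]. *)
Definition hat_laplace (R : realType) (s d c : R) : R :=
  (if c == 0 then s * d - 1 + expR (- (s * d))
   else expR (- (s * c)) * (expR (s * d) - 2 + expR (- (s * d)))) / (s ^+ 2 * d).

(** Each hat splits into two half cells, on which the integrand is an affine function times an
    exponential. The alternative [c j = 0] or [d <= c j] places the left half cell either outside
    [(0, T)] or inside it. *)
Lemma Rintegral_hat_exp (R : realType) (T s d : R) (J : finType) (a c : J -> R) :
  0 < s -> 0 < d ->
  (forall j, c j = 0 \/ d <= c j) -> (forall j, c j + d <= T) ->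
  (@lebesgue_measure R).-integrable `]0, T[
     (EFin \o (fun z => (\sum_j a j * phihat ((z - c j) / d)) * expR (- (s * z)))) /\
  \int[lebesgue_measure]_(z in `]0, T[)
     ((\sum_j a j * phihat ((z - c j) / d)) * expR (- (s * z))) =
  \sum_j a j * hat_laplace s d (c j).
Proof.
move=> s0 d0 c0 cT.
(* The flag [true] stands for the left half cell and [false] for the right one; [e] is the sign of
   the slope. Truncation at 0 collapses the left cell of a hat centred at 0 to a point. *)
pose p (i : J * bool) := if i.2 then Num.max 0 (c i.1 - d) else c i.1.
pose q (i : J * bool) := if i.2 then c i.1 else c i.1 + d.
pose e (b : bool) : R := if b then 1 else -1.
pose g (i : J * bool) z := (a i.1 * (1 - e i.2 * c i.1 / d) + (a i.1 * e i.2 / d) * z)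
  * expR (- (s * z)).
have c_ge0 j : 0 <= c j by case: (c0 j) => [->//|]; lra.
have [||||| iF ->] := @Rintegral_piecewise R 0 T (J * bool)%type p q g
   (fun z => (\sum_j a j * phihat ((z - c j) / d)) * expR (- (s * z))) (range c).
- by apply: finite_set_countable; apply: finite_image; exact: finite_finset.
- by move=> [j []]; rewrite /p/= ?c_ge0// le_max lexx.
- by move=> [j []]; rewrite /q/= ?cT// (le_trans _ (cT j))//; lra.
- by move=> i; exact: continuous_affine_exp.
- move=> z /andP[z0 zT] Nz.
  rewrite -(pair_bigA _ (fun j b => g (j, b) z * \1_`]p (j, b), q (j, b)[ z))/=.
  rewrite mulr_suml; apply: eq_bigr => j _.
  rewrite big_bool/= phihatE//; last by apply/eqP => zc; apply: Nz; exists j.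
  rewrite /g/= (_ : \1_`]p (j, true), q (j, true)[ z = \1_`]c j - d, c j[ z).
    by field; rewrite gt_eqF.
  by rewrite !indicE !mem_setE !in_itv /= /p /q/= gt_max z0.
split=> //; rewrite -(pair_bigA _ (fun j b =>
  \int[lebesgue_measure]_(x in `[p (j, b), q (j, b)]) g (j, b) x))/=.
apply: eq_bigr => j _; rewrite big_bool/= /p/q/g/e/=.
have dn0 : d != 0 by rewrite gt_eqF.
have sn0 : s != 0 by rewrite gt_eqF.
rewrite [X in _ + X]Rintegral_affine_exp//; last lra.
rewrite /hat_laplace; case: (c0 j) => [->|dc].
  rewrite eqxx (_ : Num.max 0 (0 - d) = 0); last by rewrite maxEle; case: ifPn; lra.
  rewrite set_itv1 Rintegral_set1 add0r add0r !mulr0 oppr0 expR0.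
  by field; rewrite ?sn0 ?dn0.
rewrite gt_eqF; last lra.
rewrite (_ : Num.max 0 (c j - d) = c j - d); last by rewrite maxEle; case: ifPn; lra.
rewrite Rintegral_affine_exp//; last lra.
rewrite (_ : - (s * (c j - d)) = - (s * c j) + s * d); last by ring.
rewrite (_ : - (s * (c j + d)) = - (s * c j) - s * d); last by ring.
rewrite !expRD; field.
by rewrite ?sn0 ?dn0.
Qed.

(** The slope of a hat is constant on each half cell, with opposite signs, which produces the
    difference of two integrals of [h]. The function [f] is prescribed only off [N] because it will
    be a z-integral of a classical derivative, uncontrolled at the kinks. *)
Lemma Rintegral_hat_slope (R : realType) (A B d : R) (I : finType) (a c : I -> R)
    (h f : R -> R) (N : set R) :
  0 < d -> (forall i, A <= c i - d) -> (forall i, c i + d <= B) ->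
  continuous h -> countable N ->
  (forall x, A < x < B -> ~ N x ->
     f x = (\sum_i a i * ((\1_`]c i - d, c i[ x - \1_`]c i, c i + d[ x) / d)) * h x) ->
  \int[lebesgue_measure]_(x in `]A, B[) f x =
  \sum_i a i / d * (\int[lebesgue_measure]_(x in `[c i - d, c i]) h x -
                    \int[lebesgue_measure]_(x in `[c i, c i + d]) h x).
Proof.
move=> d0 cA cB ch cN fE.
pose p (i : I * bool) := if i.2 then c i.1 - d else c i.1.
pose q (i : I * bool) := if i.2 then c i.1 else c i.1 + d.
pose e (b : bool) : R := if b then 1 else -1.
pose g (i : I * bool) x := (a i.1 * e i.2 / d) * h x.
have [||||| _ ->] := @Rintegral_piecewise R A B (I * bool)%type p q g f N => //.
- by move=> [j []]; rewrite /p/= ?cA// (le_trans (cA j))//; lra.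
- by move=> [j []]; rewrite /q/= ?cB// (le_trans _ (cB j))//; lra.
- by move=> i x; apply: cvgMr; exact: ch.
- move=> x xAB Nx; rewrite fE//.
  rewrite -(pair_bigA _ (fun j b => g (j, b) x * \1_`]p (j, b), q (j, b)[ x))/=.
  rewrite mulr_suml; apply: eq_bigr => j _.
  by rewrite big_bool/= /g/e/p/q/=; ring.
rewrite -(pair_bigA _ (fun j b =>
  \int[lebesgue_measure]_(x in `[p (j, b), q (j, b)]) g (j, b) x))/=.
apply: eq_bigr => j _; rewrite big_bool/= /p/q/g/e/=.
have ih u w : (@lebesgue_measure R).-integrable `[u, w] (EFin \o h).
  apply: continuous_compact_integrable; first exact: segment_compact.
  exact: continuous_subspaceT.
rewrite !RintegralZl//; ring.
Qed.

(** * The transform of a tensor function *)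

Lemma expiD (R : realType) (s t : R) : expi (s + t) = expi s * expi t.
Proof.
by rewrite /expi; apply/eqP; rewrite eq_complex/= cosD sinD eqxx/= addrC.
Qed.

(* The x-integral gives second differences of cosine and sine over the grid;
   the angle addition formulas turn them into the factor [2 (1 - cos th) / th],
   [th = lam v dx]. *)
Lemma Tf_tensor (R : realType) (L T v lam dx dz : R) (m : nat) (J : finType)
    (a xc : 'I_m -> R) (b zc : J -> R) :
  0 < v -> 0 < lam -> 0 < dx -> 0 < dz ->
  (forall i, - (L / 2) <= xc i - dx) -> (forall i, xc i + dx <= L / 2) ->
  (forall j, zc j = 0 \/ dz <= zc j) -> (forall j, zc j + dz <= T) ->
  Tf L T (fun q => (\sum_i a i * phihat ((q.1 - xc i) / dx)) *
                   (\sum_j b j * phihat ((q.2 - zc j) / dz)) * \1_(Omega L T) q) v lam =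
  Complex ((\sum_j b j * hat_laplace (lam ^+ 2 * v) dz (zc j)) *
     (2 * (1 - cos (lam * v * dx)) / (lam * v * dx)) *
     \sum_i a i * sin (lam * v * xc i))
    ((\sum_j b j * hat_laplace (lam ^+ 2 * v) dz (zc j)) *
     (2 * (1 - cos (lam * v * dx)) / (lam * v * dx)) *
     \sum_i a i * cos (lam * v * xc i)).
Proof.
move=> v0 lam0 dx0 dz0 xA xB zc0 zcT.
set F := (fun q : R * R => _).
(* The kinks of all the hats in x; elsewhere the classical derivative exists. *)
pose N : set R := range (fun i => xc i - dx) `|` range xc `|` range (fun i => xc i + dx).
have cN : countable N.
  apply: finite_set_countable; rewrite !finite_setU.
  by split; [split|]; apply: finite_image; exact: finite_finset.
pose S x := \sum_i a i * ((\1_`]xc i - dx, xc i[ x - \1_`]xc i, xc i + dx[ x) / dx).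
pose Psi z := \sum_j b j * phihat ((z - zc j) / dz).
have dF x z : - (L / 2) < x < L / 2 -> 0 < z < T -> ~ N x ->
    partial_x F x z = S x * Psi z.
  move=> xL zT Nx; rewrite /partial_x derive1E.
  suff : is_derive x (1 : R) (fun s => F (s, z) : R) (S x * Psi z) by case.
  (* [Omega] is open, so its indicator is 1 at all nearby points and drops out of the derivative. *)
  apply: (@near_eq_is_derive _ _ _
    (fun s : R => (\sum_i a i * phihat ((s - xc i) / dx)) * Psi z)).
    near=> s.
    rewrite /F /= indicE mem_set ?mulr1//; split => /=; rewrite in_itv/= ?zT//.
    near: s; apply: (@open_nbhs_nbhs _ _ `]- (L / 2), L / 2[%classic); split.
      exact: interval_open.
    by rewrite /= in_itv.
  have dS : is_derive x (1 : R)
      (\sum_i (fun s : R => a i * phihat ((s - xc i) / dx) : R)) (S x).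
    apply: is_derive_sum => i.
    have H : is_derive x (1 : R) (fun s => phihat ((s - xc i) / dx) : R)
       ((\1_`](xc i - dx), (xc i)[ x - \1_`](xc i), (xc i + dx)[ x) / dx).
      apply: is_derive_phihat => //; apply/eqP => xE; apply: Nx.
      - by left; left; exists i.
      - by left; right; exists i.
      - by right; exists i.
    exact: is_deriveZ.
  rewrite (_ : (fun s : R => _) = fun s : R => Psi z *
      (\sum_i (fun s : R => a i * phihat ((s - xc i) / dx) : R)) s); last first.
    by apply/funext => s; rewrite mulrC fct_sumE.
  rewrite mulrC; exact: is_deriveZ.
have Bp := @Rintegral_hat_exp R T (lam ^+ 2 * v) dz J b zc _ dz0 zc0 zcT.
have [|iPsi BE] := Bp; first by rewrite mulr_gt0// exprn_gt0.
set BB := \sum_j b j * _.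
have al0 : lam * v != 0 by rewrite mulf_neq0 ?gt_eqF.
(* Here [h] is the cosine or sine of the phase, for the real or imaginary part. It does not depend
   on z, so the z-integral contributes only the constant [BB]. *)
have inner (h : R -> R) x : - (L / 2) < x < L / 2 -> ~ N x ->
    \int[lebesgue_measure]_(z in `]0, T[)
      (partial_x F x z * expR (- (lam ^+ 2 * v * z)) * h x) = S x * (BB * h x).
  move=> xL Nx; rewrite /BB -BE.
  rewrite (_ : S x * _ = (S x * h x) * \int[lebesgue_measure]_(z in `]0, T[)
    ((\sum_j b j * phihat ((z - zc j) / dz)) * expR (- (lam ^+ 2 * v * z)))); last by ring.
  rewrite -RintegralZl//; apply: eq_Rintegral => z /set_mem /=.
  by rewrite in_itv/= => zT; rewrite dF// /Psi; ring.
have outer (h : R -> R) : continuous h ->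
    \int[lebesgue_measure]_(x in `](- (L / 2)), (L / 2)[)
      (\int[lebesgue_measure]_(z in `]0, T[)
        (partial_x F x z * expR (- (lam ^+ 2 * v * z)) * h x)) =
    BB * \sum_i a i / dx * (\int[lebesgue_measure]_(x in `[xc i - dx, xc i]) h x -
                    \int[lebesgue_measure]_(x in `[xc i, xc i + dx]) h x).
  move=> ch.
  rewrite (@Rintegral_hat_slope _ _ _ dx _ a xc (fun x => BB * h x) _ N)//.
  - rewrite mulr_sumr; apply: eq_bigr => i _.
    have ih u w : (@lebesgue_measure R).-integrable `[u, w] (EFin \o h).
      apply: continuous_compact_integrable; first exact: segment_compact.
      exact: continuous_subspaceT.
    by rewrite !RintegralZl//; ring.
  - by move=> x; apply: cvgMr; exact: ch.
  - by move=> x xL Nx; rewrite inner.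
rewrite /Tf /Cintegral; congr Complex.
- transitivity (\int[lebesgue_measure]_(x in `](- (L / 2)), (L / 2)[)
      (\int[lebesgue_measure]_(z in `]0, T[)
        (partial_x F x z * expR (- (lam ^+ 2 * v * z)) * cos (lam * v * x)))).
    apply: eq_Rintegral => x _ /=; apply: eq_Rintegral => z _ /=.
    by rewrite !mulr0 !mul0r addr0 !mul0r !subr0 cosN.
  rewrite outer; last first.
    move=> x; apply: continuous_comp; [exact: mulrl_continuous|exact: continuous_cos].
  rewrite -mulrA; congr (_ * _); rewrite mulr_sumr; apply: eq_bigr => i _.
  rewrite !Rintegral_cosM//; [|lra..].
  rewrite (mulrBr (lam * v)) (mulrDr (lam * v)) sinB sinD; field.
  by rewrite !gt_eqF.
- transitivity (\int[lebesgue_measure]_(x in `](- (L / 2)), (L / 2)[)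
      (\int[lebesgue_measure]_(z in `]0, T[)
        (partial_x F x z * expR (- (lam ^+ 2 * v * z)) * sin (- (lam * v) * x)))).
    apply: eq_Rintegral => x _ /=; apply: eq_Rintegral => z _ /=.
    by rewrite !mulr0 !mul0r addr0 !mul0r addr0 subr0 mulNr.
  rewrite outer; last first.
    move=> x; apply: continuous_comp; [exact: mulrl_continuous|exact: continuous_sin].
  rewrite -mulrA; congr (_ * _); rewrite mulr_sumr; apply: eq_bigr => i _.
  rewrite !Rintegral_sinM ?oppr_eq0//; [|lra..].
  rewrite !mulNr !cosN (mulrBr (lam * v)) (mulrDr (lam * v)) cosB cosD; field.
  by rewrite !gt_eqF.
Unshelve. all: by end_near. Qed.

(** * Spans of finite families *)

(** A combination in [linear_span] may repeat vectors. Choosing an index for each of them and adding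
    the coefficients that share an index gives a combination over ['I_n]. *)
Lemma linear_span_range (R : realType) (V : lmodType R) (n : nat) (b : 'I_n -> V) :
  linear_span (range b) = [set f | exists c : 'I_n -> R, f = \sum_i c i *: b i].
Proof.
apply/seteqP; split=> [f [m [c [e [eb ->]]]]|f [c ->]]; last first.
  by exists n, c, b; split=> // i; exists i.
have /choice[k kE] : forall i, exists j, b j = e i.
  by move=> i; have [j _ <-] := eb i; exists j.
exists (fun j => \sum_(i < m | k i == j) c i).
rewrite (partition_big k predT)//=; apply: eq_bigr => j _.
by rewrite scaler_suml; apply: eq_bigr => i /eqP <-; rewrite kE.
Qed.

Lemma linear_subspace_span (R : realType) (V : lmodType R) (n : nat) (b : 'I_n -> V) :
  linear_subspace (linear_span (range b)).
Proof.
rewrite linear_span_range; split.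
  by exists (fun=> 0); rewrite big1// => i _; rewrite scale0r.
move=> a f g [c ->] [d ->]; exists (fun i => a * c i + d i).
rewrite scaler_sumr -big_split; apply: eq_bigr => i _.
by rewrite scalerDl scalerA.
Qed.

Lemma linear_span_subset (R : realType) (V : lmodType R) (A B : set V) :
  A `<=` B -> linear_span A `<=` linear_span B.
Proof. by move=> AB f [n [c [b [bA ->]]]]; exists n, c, b; split=> // i; exact/AB. Qed.

(** * Counting zeros, and quadrature nodes near 1 *)

(** A nonzero polynomial of degree less than [n] cannot vanish at the [n] or more distinct values
    that [u] takes on [s]. *)
Lemma exists_nonroot (R : realType) (n : nat) (c : 'I_n -> R) (u : R -> R[i])
    (s : seq R) : (exists i, c i != 0) -> uniq s -> (n <= size s)%N ->
  {in s &, injective u} ->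
  exists2 x, x \in s & \sum_i (c i)%:C%C * u x ^+ i != 0.
Proof.
move=> [i0 ci0] us ns iu.
(* [insub] turns an exponent into an index in ['I_n]; its default 0 never occurs, since the
   exponents stay below [n]. *)
pose p : {poly R[i]} := \poly_(i < n) if insub i is Some j then (c j)%:C%C else 0.
have pE x : \sum_i (c i)%:C%C * x ^+ i = p.[x].
  rewrite horner_poly; apply: eq_bigr => i _.
  by rewrite insubT//= => lt_in; congr ((c _)%:C%C * _); apply: val_inj.
have p0 : p != 0.
  apply/eqP => /(congr1 (fun q : {poly _} => q`_i0)).
  rewrite coef0 coef_poly ltn_ord insubT//= => lt_in [] ci.
  by move: ci0; rewrite (_ : i0 = Ordinal lt_in) ?ci ?eqxx//; apply: val_inj.
case: (boolP (has (fun x => p.[u x] != 0) s)) => [/hasP[x xs px]|/hasPn H].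
  by exists x => //; rewrite pE.
have := @max_poly_roots _ p (map u s) p0.
rewrite map_inj_in_uniq// us size_map ltnNge (leq_trans (size_poly _ _) ns).
move=> F; suff /F/(_ isT) : all (root p) (map u s) by [].
apply/allP => _ /mapP[x xs ->].
by have := H _ xs; rewrite negbK.
Qed.

Lemma quadrature_nodes_lt (R : realType) (Lambda : R) (K : nat) (lam : nat -> R) :
  quadrature_nodes Lambda K lam ->
  forall i j, (1 <= i)%N -> (i < j)%N -> (j <= K)%N -> lam i < lam j.
Proof.
move=> [_ lS _] i j i1; elim: j => // j IH; rewrite ltnS leq_eqVlt => /predU1P[<-|ij] jK.
  by apply: lS; rewrite i1.
by apply: (lt_trans (IH ij (ltnW jK))); apply: lS; rewrite jK (leq_trans _ ij).
Qed.

Lemma quadrature_nodes_ge1 (R : realType) (Lambda : R) (K : nat) (lam : nat -> R) j :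
  quadrature_nodes Lambda K lam -> (1 <= j <= K)%N -> 1 <= lam j.
Proof.
move=> hq /andP[]; rewrite leq_eqVlt => /predU1P[<-|j1] jK; first by case: hq.
have [l1 _ _] := hq; apply: (le_trans l1); apply: ltW.
exact: (quadrature_nodes_lt hq).
Qed.

(** The extended nodes start at 1 with gaps below [dl = (beta - 1) / (n + 2)], so for [k > 0] the
    k-th one lies below [1 + k * dl]. The first node may equal 1, an endpoint excluded from the
    window; the nodes selected are therefore those of index 2 to [n + 1]. *)
Lemma quadrature_nodes_near1 (R : realType) (Lambda beta : R) (K n : nat)
    (lam : nat -> R) :
  1 < beta <= Lambda -> quadrature_nodes Lambda K lam ->
  max_stepsize Lambda K lam < (beta - 1) / n.+2%:R ->
  (forall j, (j < n)%N -> (j.+2 <= K)%N /\ 1 < lam j.+2 < beta) /\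
  {in [pred j | (0 < j <= K)%N] &, injective lam}.
Proof.
move=> /andP[b1 bL] hq hstep; have lmono := quadrature_nodes_lt hq.
have [l1 lS lK] := hq.
split; last first.
  move=> i j /andP[i0 iK] /andP[j0 jK] lE; apply/eqP; case: ltngtP => // ij.
    by have := lmono _ _ i0 ij jK; rewrite lE ltxx.
  by have := lmono _ _ j0 ij iK; rewrite lE ltxx.
set dl := (beta - 1) / n.+2%:R in hstep *.
have step k : (k <= K)%N -> extended_node Lambda K lam k.+1 < extended_node Lambda K lam k + dl.
  move=> kK; rewrite -ltrBlDl; apply: le_lt_trans hstep.
  rewrite /max_stepsize.
  exact: (le_bigmax _ (fun k : 'I_K.+1 => extended_node Lambda K lam k.+1 -
    extended_node Lambda K lam k) (Ordinal (kK : (k < K.+1)%N))).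
have ext k : (k <= K.+1)%N -> (0 < k)%N -> extended_node Lambda K lam k < 1 + k%:R * dl.
  elim: k => // k IH kK _.
  apply: (lt_le_trans (step k kK)).
  case: k IH kK => [|k] IH kK; first by rewrite /extended_node/= mul1r.
  rewrite -[X in _ <= _ + X * _]natr1 mulrDl mul1r addrA lerD2r ltW//.
  by apply: IH => //; exact: ltnW.
have dlE : n.+2%:R * dl = beta - 1 by rewrite mulrC divfK// pnatr_eq0.
have dl0 : 0 < dl by rewrite divr_gt0// ?ltr0n// subr_gt0.
(* With too few nodes, the extended node of index [K + 1], which is [Lambda], would already lie
   below [beta]. *)
have nK : (n < K)%N.
  rewrite ltnNge; apply/negP => Kn.
  have := ext K.+1 (leqnn _) isT; rewrite /extended_node eqxx /=.
  suff : K.+1%:R * dl <= n.+2%:R * dl by lra.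
  by rewrite ler_pM2r// ler_nat; lia.
move=> j jn; have jK : (j.+2 <= K)%N by lia.
split=> //; apply/andP; split.
  by apply: (le_lt_trans l1); exact: lmono.
have := ext j.+2 (leqW jK) isT.
rewrite /extended_node /= ifF; last by apply/negbTE; rewrite neq_ltn ltnS jK.
suff : j.+2%:R * dl < n.+2%:R * dl by lra.
by rewrite ltr_pM2r// ltr_nat.
Qed.

(** * The weight with its singularity at 1 *)

Lemma sqrtrB1_gt0 (R : realType) (x : R) : 1 < x -> 0 < Num.sqrt (x ^+ 2 - 1).
Proof. by move=> x1; rewrite sqrtr_gt0 subr_gt0 exprn_egt1// ltW. Qed.

Lemma continuous_weight (R : realType) (x : R) : 1 < x ->
  {for x, continuous (fun y : R => y / Num.sqrt (y ^+ 2 - 1))}.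
Proof.
move=> x1; apply: cvgM; first exact: cvg_id.
apply: cvgV; first by rewrite gt_eqF// sqrtrB1_gt0.
apply: (@continuous_comp _ _ _ (fun y : R => y ^+ 2 - 1) Num.sqrt); last exact: sqrt_continuous.
apply: cvgB; [exact: exprn_continuous|exact: cvg_cst].
Qed.

(** [sqrt (x^2 - 1)] is an antiderivative of the weight. Dropping its nonnegative value at [a] makes
    the bound uniform in [a]. *)
Lemma integral_weight_bound (R : realType) (a b : R) : 1 < a -> a < b ->
  (\int[lebesgue_measure]_(x in `[a, b]) (x / Num.sqrt (x ^+ 2 - 1))%:E <=
   (Num.sqrt (b ^+ 2 - 1))%:E)%E.
Proof.
move=> a1 ab.
have dS (x : R) : 1 < x ->
    is_derive x (1 : R) (fun y : R => Num.sqrt (y ^+ 2 - 1)) (x / Num.sqrt (x ^+ 2 - 1)).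
  move=> x1; have := sqrtrB1_gt0 x1 => s0.
  have x21 : 0 < x ^+ 2 - 1 by rewrite -sqrtr_gt0.
  have dg : is_derive x (1 : R) (fun y : R => y ^+ 2 - 1) (2 * x).
    by apply: is_derive_eq; rewrite /GRing.scale/=; ring.
  have := @is_derive1_comp _ _ (fun y : R => y ^+ 2 - 1) _ _ _ (is_derive1_sqrt x21) dg.
  by rewrite (_ : (2 * _)^-1 * (2 * x) = x / Num.sqrt (x ^+ 2 - 1))//; field; rewrite gt_eqF.
rewrite (@continuous_FTC2 _ _ (fun y => Num.sqrt (y ^+ 2 - 1)))//.
- by rewrite -EFinB lee_fin lerBlDr lerDl sqrtr_ge0.
- apply: continuous_in_subspaceT => x; rewrite inE/= in_itv/= => /andP[ax _].
  by apply: continuous_weight; exact: lt_le_trans ax.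
- have cF x : 1 < x -> {for x, continuous (fun y : R => Num.sqrt (y ^+ 2 - 1))}.
    by move=> /dS[] /derivable1_diffP/differentiable_continuous.
  split; first by move=> x; rewrite in_itv/= => /andP[ax _]; case: (dS x (lt_trans a1 ax)).
    exact/cvg_at_right_filter/cF.
  by apply/cvg_at_left_filter/cF; exact: lt_trans ab.
- by move=> x; rewrite in_itv/= derive1E => /andP[ax _]; case: (dS x (lt_trans a1 ax)).
Qed.

(** Monotone convergence along intervals [[a n, b]] that exhaust [(1, b]] carries the uniform bound
    over to the singular endpoint. *)
Lemma integrable_weight (R : realType) (b : R) : 1 < b ->
  (@lebesgue_measure R).-integrable `]1, b[
    (fun x => (x / Num.sqrt (x ^+ 2 - 1))%:E).
Proof.
move=> b1.
pose f (x : R) := (x / Num.sqrt (x ^+ 2 - 1))%:E.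
pose a n : R := 1 + (b - 1) / n.+2%:R.
have a1 n : 1 < a n by rewrite ltrDl divr_gt0 ?subr_gt0// ltr0n.
have ab n : a n < b.
  rewrite -ltrBrDl ltr_pdivrMr ?ltr0n// ltr_pMr ?subr_gt0//.
  by rewrite ltr1n.
have mf (J : set R) : measurable J -> J `<=` `]1, +oo[ -> measurable_fun J f.
  move=> mJ JS; apply/measurable_EFinP; apply: measurable_funS JS _ => //.
  apply: open_continuous_measurable_fun; first exact: interval_open.
  move=> x; rewrite inE/= in_itv/= andbT; exact: continuous_weight.
have f0 x : 1 < x -> (0 <= f x)%E.
  by move=> x1; rewrite lee_fin divr_ge0 ?sqrtr_ge0//; lra.
have Un : \bigcup_n `[a n, b]%classic = `]1, b]%classic.
  apply/seteqP; split=> [x [n _]|x]; rewrite /= !in_itv/= => /andP[xa xb].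
    by rewrite xb (lt_le_trans (a1 n)).
  have x1 : 0 < x - 1 by rewrite subr_gt0.
  (* Every [n] beyond [(b - 1) / (x - 1)] satisfies [a n <= x]. *)
  have H := archi_boundP (divr_ge0 (ltW (etrans (subr_gt0 _ _) b1)) (ltW x1)).
  exists (Num.bound ((b - 1) / (x - 1))) => //=; rewrite in_itv/= xb andbT /a.
  rewrite addrC -lerBrDr ler_pdivrMr ?ltr0n// -ler_pdivrMl// mulrC.
  by apply: ltW; apply: lt_le_trans H _; rewrite ler_nat leqW// leqW.
have cvgf : ((\int[lebesgue_measure]_(x in `[a n, b]) f x)%E @[n --> \oo] -->
    (\int[lebesgue_measure]_(x in `]1%R, b]) f x)%E)%classic.
  rewrite -Un; apply: ge0_nondecreasing_set_cvg_integral => //.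
  - move=> n m nm; rewrite subsetEset; apply: subset_itvr; rewrite bnd_simp.
    rewrite lerD2l ler_pM2l ?subr_gt0// lef_pV2 ?posrE ?ltr0n// ler_nat; lia.
  - by move=> n; apply: mf => // x /=; rewrite !in_itv/= => /andP[/(lt_le_trans (a1 n)) ->].
  - by move=> n x /=; rewrite in_itv/= => /andP[/(lt_le_trans (a1 n)) /f0].
apply: (@integrableS _ _ _ lebesgue_measure `]1, b]%classic) => //.
  by apply: subset_itvl; rewrite bnd_simp.
apply/integrableP; split.
  by apply: mf => //; apply: subset_itvl; rewrite bnd_simp.
have -> : (\int[lebesgue_measure]_(x in `]1%R, b]) `|(x / Num.sqrt (x ^+ 2 - 1))%:E| =
    \int[lebesgue_measure]_(x in `]1%R, b]) f x)%E.
  apply: eq_integral => x; rewrite inE/= in_itv/= => /andP[x1 _].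
  by rewrite ger0_norm// -lee_fin f0.
apply: (@le_lt_trans _ _ (Num.sqrt (b ^+ 2 - 1))%:E); last exact: ltry.
apply: (cvge_le _ cvgf).
by apply: nearW => n; exact: integral_weight_bound.
Qed.

(** * Positivity of the weighted integral *)

(** If the integral were 0, the nonnegative integrand would vanish almost everywhere, and so would
    [N] on [(1, beta)]. But by the last hypothesis [N] has fewer than [n] zeros there. *)
Lemma Rintegral_weight_gt0 (R : realType) (Lambda beta : R) (n : nat) (N : R -> R) :
  1 < beta <= Lambda -> (forall x, 0 < x -> 0 <= N x) ->
  (forall x, 0 < x -> {for x, continuous N}) ->
  (forall s : seq R, uniq s -> (n <= size s)%N -> (forall x, x \in s -> 1 < x < beta) ->
     exists2 x, x \in s & N x != 0) ->
  0 < \int[lebesgue_measure]_(x in `]1, Lambda[)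
        (N x * (x ^+ 2 / Num.sqrt (x ^+ 2 - 1))).
Proof.
move=> /andP[b1 bL] N0 cN nz; have L1 : 1 < Lambda by exact: lt_le_trans bL.
(* One factor [x] stays with the weight, whose integrability is known; the other joins [N], and
   [N x * x] is bounded on [[1, Lambda]] by continuity. *)
pose w (x : R) := x / Num.sqrt (x ^+ 2 - 1).
pose G x := N x * (x ^+ 2 / Num.sqrt (x ^+ 2 - 1)).
have w0 x : 1 < x -> 0 < w x.
  by move=> x1; rewrite divr_gt0 ?sqrtrB1_gt0//; lra.
have GE x : G x = N x * x * w x by rewrite /G /w expr2 !mulrA.
have G0 x : `]1, Lambda[%classic x -> 0 <= G x.
  rewrite /= in_itv/= => /andP[x1 _]; rewrite GE mulr_ge0 ?(ltW (w0 _ _))//.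
  by have x0 := lt_trans ltr01 x1; rewrite mulr_ge0 ?N0 ?(ltW x0).
have [M MN] : exists M, forall x, 1 < x < Lambda -> N x * x <= M.
  have : {within `[1, Lambda], continuous (fun x => N x * x)}.
    apply: continuous_in_subspaceT => x; rewrite inE/= in_itv/= => /andP[x1 _].
    by apply: cvgM; [apply: cN; lra|exact: cvg_id].
  move=> /(EVT_max (ltW L1))[c _ cM]; exists (N c * c) => x /andP[x1 xL].
  by apply: cM; rewrite in_itv/= !ltW.
have mG : measurable_fun `]1, Lambda[%classic G.
  apply: open_continuous_measurable_fun; first exact: interval_open.
  move=> x; rewrite inE/= in_itv/= => /andP[x1 _].
  rewrite (_ : G = fun x => N x * x * w x); last by apply/funext.
  apply: cvgM; last exact: continuous_weight.
  by apply: cvgM; [apply: cN; lra|exact: cvg_id].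
have iG : (@lebesgue_measure R).-integrable `]1, Lambda[ (EFin \o G).
  apply: (@le_integrable _ _ _ lebesgue_measure `]1, Lambda[%classic _
    (EFin \o G) (fun x => M%:E * (w x)%:E)%E) => //.
  - exact/measurable_EFinP.
  - move=> x; rewrite /= in_itv/= => xI; have /andP[x1 _] := xI.
    have M0 : 0 <= M.
      by have x0 := lt_trans ltr01 x1; rewrite (le_trans _ (MN _ xI))// mulr_ge0 ?N0 ?(ltW x0).
    have Gx : 0 <= G x by apply: G0; rewrite /= in_itv.
    rewrite lee_fin (ger0_norm Gx) ger0_norm; last by rewrite mulr_ge0 ?(ltW (w0 _ _)).
    by rewrite GE ler_pM2r ?w0// MN.
  - exact/integrableZl/integrable_weight.
rewrite lt_neqAle Rintegral_ge0 ?andbT//.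
apply/eqP => /esym I0.
have Iabs : (\int[lebesgue_measure]_(x in `]1%R, Lambda[) `|(EFin \o G) x|)%E = 0%E.
  have -> : (\int[lebesgue_measure]_(x in `]1%R, Lambda[) `|(EFin \o G) x| =
      \int[lebesgue_measure]_(x in `]1%R, Lambda[) (EFin \o G) x)%E.
    by apply: eq_integral => x /set_mem xI /=; rewrite ger0_norm// G0.
  rewrite -[LHS]fineK; last exact: integrable_fin_num.
  by rewrite [fine _]I0.
have mEG : measurable_fun `]1, Lambda[%classic (EFin \o G) by exact/measurable_EFinP.
have [A [mA A0 GA]] := proj1 (@ae_eq_integral_abs _ _ _ lebesgue_measure
  `]1, Lambda[%classic ltac:(by []) _ mEG) Iabs.
(* An infinite [Z] would contain [n] distinct zeros, contrary to the hypothesis. *)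
pose Z := [set x | 1 < x < beta /\ N x = 0].
have fZ : finite_set Z.
  apply: contrapT => /(@infinite_set_fset _ _ n)[B BZ nB].
  have [||x xB] := nz (finmap.enum_fset B) _ nB.
  - exact: finmap.fset_uniq.
  - by move=> x xB; have [] := BZ x xB.
  - by have [_ ->] := BZ x xB; rewrite eqxx.
have Z0 : lebesgue_measure Z = 0%E.
  exact/countable_lebesgue_measure0/finite_set_countable.
(* An interval of positive length would be covered by two null sets. *)
have : (lebesgue_measure `]1%R, beta[%classic <= lebesgue_measure (A `|` Z)%classic)%E.
  apply: le_measure; rewrite ?inE//.
    by apply: measurableU => //; exact/countable_measurable/finite_set_countable.
  move=> x; rewrite /= in_itv/= => xI; have /andP[x1 xb] := xI.
  have [Nx|Nx] := eqVneq (N x) 0; first by right.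
  left; apply: GA => /=; rewrite in_itv/= x1 (lt_le_trans xb bL) => /(_ isT)[] /eqP.
  have xp : 0 < x by exact: lt_trans x1.
  apply/negP; rewrite GE; apply: mulf_neq0; first by rewrite mulf_neq0// gt_eqF.
  by rewrite gt_eqF// w0.
rewrite lebesgue_measure_itv/= lte_fin b1 -EFinD.
rewrite leNgt (@le_lt_trans _ _ (lebesgue_measure A + lebesgue_measure Z)%E)//.
  by apply: measureU2 => //; exact/countable_measurable/finite_set_countable.
by rewrite A0 Z0 adde0 lte_fin subr_gt0.
Qed.

(** * Injectivity of the phase near 1 *)

Lemma cos_neq1 (R : realType) (t : R) : 0 < t < pi *+ 2 -> cos t != 1.
Proof.
move=> /andP[t0 t2]; have := sin_gt0_pi (x := t / 2).
have -> : cos t = 1 - (sin (t / 2) ^+ 2) *+ 2.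
  rewrite -[in LHS](_ : (t / 2) *+ 2 = t); last by rewrite -mulr_natr divfK.
  by rewrite cos_mulr2n cos2sin2; ring.
rewrite divr_gt0// ltr_pdivrMr// mulr_natr t2 => /(_ isT) s0.
by rewrite lt_eqF// gtrBl pmulrn_rgt0// exprn_gt0.
Qed.

(** Equal values force [cos (s - t) = 1], which in the given range leaves only [s = t]. *)
Lemma expi_inj (R : realType) (s t : R) : `|s - t| < pi *+ 2 -> expi s = expi t -> s = t.
Proof.
move=> st [cst sst]; apply/eqP; rewrite -subr_eq0 -normr_eq0; apply/negPn/negP => st0.
have := @cos_neq1 R `|s - t|; rewrite lt_def st0 normr_ge0 st cos_norm => /(_ isT).
by rewrite cosB cst sst -!expr2 cos2Dsin2 eqxx.
Qed.

Lemma expiX (R : realType) (t : R) (n : nat) : expi t ^+ n = expi (n%:R * t).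
Proof.
elim: n => [|n IH]; first by rewrite expr0 mul0r /expi cos0 sin0.
by rewrite exprS IH -expiD -[n.+1%:R]nat1r mulrDl mul1r.
Qed.

(** Below [1 + 2 pi / th] the phases [lam * th] range over less than a full turn, so the exponential
    is injective. The points with [cos (lam * th) = 1] share one phase, so at most one lies in this
    window. *)
Lemma exists_phase_window (R : realType) (th Lambda : R) : 0 < th -> 1 < Lambda ->
  exists beta, [/\ 1 < beta <= Lambda,
    forall lam, 1 < lam < beta -> cos (lam * th) != 1 &
    forall lam mu, 1 < lam < beta -> 1 < mu < beta ->
      expi (- (lam * th)) = expi (- (mu * th)) -> lam = mu].
Proof.
move=> th0 L1.
have p0 : 0 < pi *+ 2 / th :> R by rewrite divr_gt0// pmulrn_rgt0// pi_gt0.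
pose b0 := Num.min Lambda (1 + pi *+ 2 / th).
have b01 : 1 < b0 by rewrite lt_min L1 ltrDl.
have b0L : b0 <= Lambda by rewrite ge_min lexx.
have small lam mu : 1 < lam < b0 -> 1 < mu < b0 -> `|lam * th - mu * th| < pi *+ 2.
  rewrite !lt_min => /and3P[l1 _ l2] /and3P[m1 _ m2].
  rewrite -mulrBl normrM (gtr0_norm th0) -ltr_pdivlMr// ltr_norml; lra.
have inj lam mu : 1 < lam < b0 -> 1 < mu < b0 ->
    expi (- (lam * th)) = expi (- (mu * th)) -> lam = mu.
  move=> hl hm /expi_inj H; apply: (mulIf (lt0r_neq0 th0)); apply: oppr_inj; apply: H.
  by rewrite opprK addrC small.
(* If the exceptional point [l0] exists, the window is cut off there. *)
have [[l0 [hl0 cl0]]|H] := pselect (exists l0, 1 < l0 < b0 /\ cos (l0 * th) = 1); last first.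
  exists b0; split; [by rewrite b01|move=> lam hl|exact: inj].
  by apply/eqP => cl; apply: H; exists lam.
have /andP[l01 l0b] := hl0.
have sub lam : 1 < lam < l0 -> 1 < lam < b0 by move=> /andP[-> /lt_trans ->].
exists l0; split.
- by rewrite l01 (le_trans (ltW l0b)).
- move=> lam hl; apply/eqP => cl.
  have sin0 x : cos x = 1 -> sin x = 0 :> R.
    by move=> cx; apply: cos1sin0; rewrite cx normr1.
  have := inj lam l0 (sub _ hl) hl0.
  rewrite /expi !sinN !cosN cl cl0 !sin0// => /(_ erefl) E.
  by move: hl; rewrite E ltxx andbF.
- by move=> lam mu hl hm; apply: inj; exact: sub.
Qed.

(** * From formulas for the transform to positive subspaces *)

(** The common shape of both conclusions, with [Q] the integral or the quadrature form of the wave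
    resistance. *)
Definition positive_subspace (R : realType) (V : set (plane_fun R)) (n : nat)
    (Q : plane_fun R -> R) : Prop :=
  exists (Wh : set (plane_fun R)) (d : nat),
    [/\ linear_subspace Wh, Wh `<=` V, has_dimension Wh d, (n <= d)%N &
        forall f : plane_fun R, Wh f -> f <> 0 -> 0 < Q f].

(* [C] collects the factors of [T] common to all basis functions; what is left
   is a polynomial in [u lam] of degree less than [n]. *)
Lemma positive_subspace_of_basis (R : realType) (L T rho g v Lambda beta : R)
    (n m : nat) (V : set (plane_fun R)) (b : 'I_n -> plane_fun R) (C u : R -> R[i])
    (N : ('I_n -> R) -> R -> R) :
  0 < rho -> 0 < g -> 0 < v -> 1 < beta <= Lambda -> (m <= n)%N ->
  linear_span (range b) `<=` V ->
  (forall c lam, 0 < lam ->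
     Tf L T (\sum_i c i *: b i) v lam = C lam * \sum_i (c i)%:C%C * u lam ^+ i) ->
  (forall lam, 1 < lam < beta -> C lam != 0) ->
  (forall lam mu, 1 < lam < beta -> 1 < mu < beta -> u lam = u mu -> lam = mu) ->
  (forall c lam, 0 < lam -> {for lam, continuous (N c)}) ->
  (forall c lam, 0 < lam ->
     Normc.normc (Tf L T (\sum_i c i *: b i) v lam) ^+ 2 = N c lam) ->
  positive_subspace V m (R_integral L T rho g Lambda v) /\
  exists delta : R, 0 < delta /\ forall (K : nat) (lam w : nat -> R),
    (1 <= K)%N -> quadrature_nodes Lambda K lam -> max_stepsize Lambda K lam < delta ->
    (forall j : nat, (1 <= j <= K)%N -> 0 < w j) ->
    positive_subspace V m (R_quadrature L T rho g K lam w v).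
Proof.
move=> rho0 g0 v0 bL mn bV HT HC Hu Nc NE.
have b1 : 1 < beta by case/andP: bL.
have coef0 : 0 < 4 * rho * g * v / pi by rewrite divr_gt0 ?pi_gt0// !mulr_gt0.
(* [N c] is the squared modulus of the transform. Since [C] has no zero in the window, it is nonzero
   wherever the polynomial in [u] is. *)
have nz c (s : seq R) : (exists i, c i != 0) -> uniq s -> (n <= size s)%N ->
    (forall x, x \in s -> 1 < x < beta) -> exists2 x, x \in s & N c x != 0.
  move=> ci us ns sb; have [|x xs px] := @exists_nonroot R n c u s ci us ns.
    by move=> x y xs ys; apply: Hu; exact: sb.
  have x1 := sb _ xs.
  exists x => //; rewrite -NE; last by case/andP: x1 => x1 _; apply: lt_trans x1.
  rewrite expf_neq0//; apply/eqP => /Normc.eq0_normc /eqP.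
  rewrite HT; last by case/andP: x1 => x1 _; apply: lt_trans x1.
  by rewrite mulf_eq0 (negbTE (HC _ x1)) (negbTE px).
have free : linearly_independent b.
  move=> c c0 i; apply/eqP/negPn/negP => ci.
  (* A sample of [n] distinct points of the window; a vanishing combination with a nonzero
     coefficient would have nonzero transform at one of them. *)
  pose s : seq R := [seq 1 + (beta - 1) / (k.+2)%:R | k <- iota 0 n].
  have [||x|x xs] := @nz c s (ex_intro _ i ci).
  - rewrite map_inj_uniq ?iota_uniq// => k l /addrI /mulfI.
    rewrite subr_eq0 gt_eqF// => /(_ isT)/invr_inj/eqP.
    by rewrite eqr_nat => /eqP[].
  - by rewrite size_map size_iota.
  - move=> /mapP[k _ ->]; rewrite ltrDl divr_gt0 ?subr_gt0 ?ltr0n//=.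
    by rewrite -ltrBrDl ltr_pdivrMr ?ltr0n// ltr_pMr ?subr_gt0// ltr1n.
  - have x1 : 0 < x.
      move: xs => /mapP[k _ ->]; rewrite addr_gt0// divr_gt0 ?subr_gt0//.
    rewrite -NE// c0.
    (* The transform of the zero function is read off from [HT] with zero coefficients. *)
    have := HT (fun=> 0) x x1; rewrite big1; last by move=> j _; rewrite scale0r.
    by move=> ->; rewrite big1 ?mulr0 ?Normc.normc0 ?expr0n ?eqxx// => j _; rewrite mul0r.
have sp Q : (forall c, (exists i, c i != 0) -> 0 < Q (\sum_i c i *: b i)) ->
    positive_subspace V m Q.
  move=> Qpos; exists (linear_span (range b)), n; split=> //.
  - exact: linear_subspace_span.
  - by exists b.
  - rewrite linear_span_range => f [c ->] f0; apply: Qpos.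
    apply: contrapT => /forallNP c0; apply: f0; apply: big1 => i _.
    by have /negP := c0 i; rewrite negbK => /eqP ->; rewrite scale0r.
split.
  apply: sp => c ci; rewrite /R_integral mulr_gt0//.
  rewrite (_ : Rintegral _ _ _ = \int[lebesgue_measure]_(x in `]1, Lambda[)
      (N c x * (x ^+ 2 / Num.sqrt (x ^+ 2 - 1)))); last first.
    apply: eq_Rintegral => x; rewrite inE/= in_itv/= => /andP[x1 _].
    by rewrite NE// (lt_trans _ x1).
  apply: (Rintegral_weight_gt0 bL) => [x x0|x x0|s]; last exact: nz.
    by rewrite -NE// sqr_ge0.
  exact: Nc.
(* This bound depends only on the window and the number of basis functions, hence is uniform in the
   nodes and weights. *)
exists ((beta - 1) / n.+2%:R); split; first by rewrite divr_gt0 ?ltr0n// subr_gt0.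
move=> K lam w K1 hq hs w0; apply: sp => c ci.
have [near1 inj] := quadrature_nodes_near1 bL hq hs.
rewrite /R_quadrature mulr_gt0//.
have lam1 j : (1 <= j <= K)%N -> 0 < lam j.
  by move=> jK; apply: lt_le_trans (quadrature_nodes_ge1 hq jK).
pose s := [seq lam j.+2 | j <- iota 0 n].
have [||x|x /mapP[j]] := @nz c s ci.
- rewrite map_inj_in_uniq ?iota_uniq// => i j; rewrite !mem_iota !add0n/= => hi hj /inj.
  by rewrite !inE /= !(near1 _ _).1// => /(_ isT isT)[].
- by rewrite size_map size_iota.
- by move=> /mapP[j]; rewrite mem_iota add0n => /= hj ->; case: (near1 j hj).
rewrite mem_iota leq0n andTb add0n => hj -> Nj; have [jK _] := near1 j hj.
(* The node at which [N c] is nonzero gives a positive term; all others are nonnegative. *)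
rewrite (bigD1_seq j.+2) ?iota_uniq ?mem_index_iota//.
rewrite big_seq_cond ltr_wpDr//.
  apply: sumr_ge0 => k /andP[]; rewrite mem_index_iota ltnS => kK _.
  by rewrite mulr_ge0 ?sqr_ge0// ltW// w0.
by rewrite NE ?lam1// mulr_gt0 ?w0// lt_def Nj -NE ?lam1// sqr_ge0.
Qed.

(** * Continuity of the squared modulus in lam *)

Lemma continuous_hat_laplace (R : realType) (v d c lam : R) : 0 < v -> 0 < d -> 0 < lam ->
  {for lam, continuous (fun x : R => hat_laplace (x ^+ 2 * v) d c)}.
Proof.
move=> v0 d0 l0; rewrite /hat_laplace.
have cs (e : R) : {for lam, continuous (fun x : R => x ^+ 2 * v * e)}.
  apply: cvgM; last exact: cvg_cst.
  by apply: cvgM; [exact: exprn_continuous|exact: cvg_cst].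
have cE (e : R) : {for lam, continuous (fun x : R => expR (x ^+ 2 * v * e))}.
  exact: (continuous_comp (cs e) (@continuous_expR _ _)).
have cEN (e : R) : {for lam, continuous (fun x : R => expR (- (x ^+ 2 * v * e)))}.
  exact: (continuous_comp (cvgN (cs e)) (@continuous_expR _ _)).
apply: cvgM.
  case: ifP => _.
    by apply: cvgD (cEN _); apply: cvgB (cs _) _; exact: cvg_cst.
  apply: cvgM (cEN _) _; apply: cvgD (cEN _); apply: cvgB (cE _) _; exact: cvg_cst.
apply: cvgV; first by rewrite !mulf_neq0 ?expf_neq0 ?gt_eqF ?mulr_gt0 ?exprn_gt0.
apply: cvgM; last exact: cvg_cst.
have := cs 1; rewrite (_ : (fun x : R => x ^+ 2 * v * 1) = fun x => x ^+ 2 * v).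
  by move=> cs1; exact: (continuous_comp cs1 (@exprn_continuous _ 2 _)).
by apply/funext => x; rewrite mulr1.
Qed.

(* Up to the factor i, [tensor_modulus] carries everything in the tensor
   formula for T except the exponential sum over the x-nodes. *)
Definition tensor_modulus (R : realType) (v dx dz : R) (J : finType)
    (b zc : J -> R) (lam : R) : R :=
  (\sum_j b j * hat_laplace (lam ^+ 2 * v) dz (zc j)) *
  (2 * (1 - cos (lam * v * dx)) / (lam * v * dx)).

(** The squared modulus of the transform in closed form, so that its continuity in [lam] follows
    without differentiating or passing limits under integrals. *)
Definition tensor_norm (R : realType) (v dx dz : R) (I J : finType)
    (a xc : I -> R) (b zc : J -> R) (lam : R) : R :=
  (tensor_modulus v dx dz b zc lam * \sum_i a i * sin (lam * v * xc i)) ^+ 2 +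
  (tensor_modulus v dx dz b zc lam * \sum_i a i * cos (lam * v * xc i)) ^+ 2.

Lemma continuous_tensor_norm (R : realType) (v dx dz : R) (I J : finType)
    (a xc : I -> R) (b zc : J -> R) (lam : R) : 0 < v -> 0 < dx -> 0 < dz -> 0 < lam ->
  {for lam, continuous (tensor_norm v dx dz a xc b zc)}.
Proof.
move=> v0 dx0 dz0 l0.
have csum (K : finType) (f : K -> R -> R) : (forall k, {for lam, continuous (f k)}) ->
    {for lam, continuous (fun y => \sum_k f k y)}.
  by move=> cf; apply: cvg_big => [|k _]; [exact: add_continuous|exact: cf].
have clin (e : R) : {for lam, continuous (fun x : R => x * v * e)}.
  by apply: cvgM; [apply: cvgM|]; [exact: cvg_id|exact: cvg_cst|exact: cvg_cst].
have ccos (e : R) : {for lam, continuous (fun x : R => cos (x * v * e))}.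
  exact: (continuous_comp (clin e) (@continuous_cos _ _)).
have csin (e : R) : {for lam, continuous (fun x : R => sin (x * v * e))}.
  exact: (continuous_comp (clin e) (@continuous_sin _ _)).
have cmod : {for lam, continuous (tensor_modulus v dx dz b zc)}.
  apply: cvgM.
    apply: csum => j; apply: cvgM; [exact: cvg_cst|exact: continuous_hat_laplace].
  apply: cvgM.
    by apply: cvgM; [exact: cvg_cst|apply: cvgB (ccos _); exact: cvg_cst].
  by apply: cvgV (clin _); rewrite !mulf_neq0 ?gt_eqF.
have csq (f : R -> R) : {for lam, continuous f} -> {for lam, continuous (fun x => f x ^+ 2)}.
  by move=> cf; exact: (continuous_comp cf (@exprn_continuous _ 2 _)).
apply: cvgD; apply: csq; apply: cvgM cmod _; apply: csum => i.
  by apply: cvgM (csin _); exact: cvg_cst.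
by apply: cvgM (ccos _); exact: cvg_cst.
Qed.

(** * The transform on grid functions *)

Lemma expi_neq0 (R : realType) (t : R) : expi t != 0.
Proof.
have E : expi t * expi (- t) = 1 by rewrite -expiD subrr /expi cos0 sin0.
by apply/eqP => e0; move: E => /eqP; rewrite e0 mul0r eq_sym oner_eq0.
Qed.

(** The identity [sin t + i cos t = i exp (- i t)] merges the two real sums of [Tf_tensor] into one
    exponential sum. The index 0 in [node] is a placeholder for the coordinate that is projected
    away. *)
Lemma Tf_grid (R : realType) (L T v lam : R) (Nx Nz m p : nat)
    (a : 'I_m -> R) (k : 'I_m -> nat) (b : 'I_p -> R) (l : 'I_p -> nat) :
  0 < L -> 0 < T -> 0 < v -> 0 < lam -> (0 < Nx)%N -> (0 < Nz)%N ->
  (forall i, (0 < k i < Nx)%N) -> (forall j, (l j < Nz)%N) ->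
  let dx := deltax L Nx in let dz := deltaz T Nz in
  let xc i := (node L T Nx Nz (k i) 0).1 in let zc j := (node L T Nx Nz 0 (l j)).2 in
  let f : plane_fun R := fun q => (\sum_i a i * phihat ((q.1 - xc i) / dx)) *
                   (\sum_j b j * phihat ((q.2 - zc j) / dz)) * \1_(Omega L T) q in
  Normc.normc (Tf L T f v lam) ^+ 2 = tensor_norm v dx dz a xc b zc lam /\
  Tf L T f v lam = (tensor_modulus v dx dz b zc lam)%:C%C * 'i%C *
    \sum_i (a i)%:C%C * expi (- (lam * v * xc i)).
Proof.
move=> L0 T0 v0 l0 Nx0 Nz0 hk hl dx dz xc zc f.
have dx0 : 0 < dx by rewrite divr_gt0// ltr0n.
have dz0 : 0 < dz by rewrite divr_gt0// ltr0n.
have dxN : Nx%:R * dx = L by rewrite mulrC divfK// pnatr_eq0 -lt0n.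
have dzN : Nz%:R * dz = T by rewrite mulrC divfK// pnatr_eq0 -lt0n.
have next (h : R) (n N : nat) : 0 < h -> (n < N)%N -> n%:R * h + h <= N%:R * h.
  by move=> h0 nN; rewrite -[X in _ + X]mul1r -mulrDl natr1 ler_wpM2r ?(ltW h0)// ler_nat.
have E : Tf L T f v lam = Complex
    (tensor_modulus v dx dz b zc lam * \sum_i a i * sin (lam * v * xc i))
    (tensor_modulus v dx dz b zc lam * \sum_i a i * cos (lam * v * xc i)).
  apply: Tf_tensor => //.
  - move=> i; have /andP[k0 _] := hk i.
    by rewrite /xc /node /= -/dx -addrA lerDl subr_ge0 ler_peMl ?(ltW dx0) ?(ltW dz0)// ler1n.
  - move=> i; have /andP[_ kN] := hk i.
    have : (k i)%:R * dx + dx <= L.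
      by rewrite -dxN next.
    by rewrite /xc /node /= -/dx; lra.
  - move=> j; rewrite /zc /node /= -/dz; case: (l j) => [|n]; first by left; rewrite mul0r.
    by right; rewrite ler_peMl ?(ltW dx0) ?(ltW dz0)// ler1n.
  - move=> j; rewrite /zc /node /= -/dz -dzN.
    by rewrite next.
split; first by rewrite E /= sqr_sqrtr// addr_ge0// sqr_ge0.
rewrite E; set P := tensor_modulus _ _ _ _ _ _.
have Csum (F G : 'I_m -> R) : Complex (\sum_i F i) (\sum_i G i) = \sum_i Complex (F i) (G i).
  apply: (big_rec3 (fun x y z => Complex x y = z)) => // i x y z _ <-.
  by apply/eqP; rewrite eq_complex/= !eqxx.
rewrite !mulr_sumr Csum; apply: eq_bigr => i _.
by apply/eqP; rewrite eq_complex /= cosN sinN; apply/andP; split; apply/eqP; ring.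
Qed.

(** Both numerators are positive by [exp t > 1 + t] for [t != 0]: at [t = - s d] if [c = 0],
    otherwise by adding the cases [t = s d] and [t = - s d]. *)
Lemma hat_laplace_gt0 (R : realType) (s d c : R) : 0 < s -> 0 < d -> 0 < hat_laplace s d c.
Proof.
move=> s0 d0; have sd0 : 0 < s * d by rewrite mulr_gt0.
have e1 : 1 + s * d < expR (s * d) by rewrite expR_gt1Dx// gt_eqF.
have e2 : 1 - s * d < expR (- (s * d)) by rewrite expR_gt1Dx// oppr_eq0 gt_eqF.
rewrite divr_gt0// ?mulr_gt0 ?exprn_gt0//; case: ifP => _; first by lra.
by rewrite mulr_gt0 ?expR_gt0//; lra.
Qed.

Lemma x_modulus_neq0 (R : realType) (th : R) : 0 < th -> cos th != 1 ->
  2 * (1 - cos th) / th != 0.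
Proof.
move=> th0 cth; have c1 : cos th < 1 by rewrite lt_neqAle cth cos_le1.
by rewrite gt_eqF// divr_gt0// mulr_gt0// subr_gt0.
Qed.

(** * Hats along a horizontal and along a vertical grid line *)

(** The basis consists of the hats on the surface [z = 0]. Their abscissae are equally spaced, so
    their phases form a geometric progression. *)
Lemma positive_subspace_x (R : realType) (L T rho g v Lambda : R) (Nx Nz : nat) :
  0 < L -> 0 < T -> 0 < rho -> 0 < g -> 0 < v -> 1 < Lambda -> (2 <= Nx)%N -> (1 <= Nz)%N ->
  positive_subspace (Vh L T Nx Nz) Nx.-1 (R_integral L T rho g Lambda v) /\
  exists delta : R, 0 < delta /\ forall (K : nat) (lam w : nat -> R),
    (1 <= K)%N -> quadrature_nodes Lambda K lam -> max_stepsize Lambda K lam < delta ->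
    (forall j : nat, (1 <= j <= K)%N -> 0 < w j) ->
    positive_subspace (Vh L T Nx Nz) Nx.-1 (R_quadrature L T rho g K lam w v).
Proof.
move=> L0 T0 rho0 g0 v0 L1 Nx2 Nz1.
have Nx0 : (0 < Nx)%N by lia.
pose dx := deltax L Nx; pose dz := deltaz T Nz.
have dx0 : 0 < dx by rewrite divr_gt0// ltr0n.
have dz0 : 0 < dz by rewrite divr_gt0// ltr0n.
have [beta [bL cosb expb]] := exists_phase_window (mulr_gt0 v0 dx0) L1.
have lt0 lam : 1 < lam < beta -> 0 < lam by move=> /andP[/(lt_trans ltr01)].
pose k (i : 'I_Nx.-1) := i.+1; pose l (j : 'I_1) := 0%N.
have hk i : (0 < k i < Nx)%N by rewrite /k; have := ltn_ord i; lia.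
pose b (i : 'I_Nx.-1) : plane_fun R := hat L T Nx Nz (node L T Nx Nz (k i) 0).
pose xc i := (node L T Nx Nz (k i) 0).1.
pose zc j := (node L T Nx Nz 0 (l j)).2.
have bE (c : 'I_Nx.-1 -> R) : \sum_i c i *: b i = (fun q =>
    (\sum_i c i * phihat ((q.1 - xc i) / dx)) *
    (\sum_(j < 1) 1 * phihat ((q.2 - zc j) / dz)) * \1_(Omega L T) q) :> plane_fun R.
  apply/funext => q; rewrite fct_sumE big_ord1 mul1r !mulr_suml.
  apply: eq_bigr => i _; have -> : (c i *: b i) q = c i * b i q by [].
  by rewrite /b /hat !mulrA.
have grid c lam (l0 : 0 < lam) := @Tf_grid R L T v lam Nx Nz _ _ c k (fun=> 1) l
  L0 T0 v0 l0 Nx0 Nz1 hk (fun=> Nz1).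
(* The nodes are [- L / 2 + (i + 1) dx]; the offset [- L / 2] and the first step [dx] go into the
   phase of the common factor, which leaves the exponent [i]. *)
apply: (@positive_subspace_of_basis R L T rho g v Lambda beta Nx.-1 _ _ b
  (fun lam => (tensor_modulus v dx dz (fun=> 1) zc lam)%:C%C * 'i%C *
     expi (lam * v * (L / 2) - lam * (v * dx)))
  (fun lam => expi (- (lam * (v * dx))))
  (fun c => tensor_norm v dx dz c xc (fun=> 1) zc)) => //.
- apply: linear_span_subset => _ [i _ <-]; exists (k i), 0%N; split=> //.
  by right.
- move=> c lam l0; rewrite bE (grid c lam l0).2 -[RHS]mulrA; congr (_ * _).
  rewrite mulr_sumr; apply: eq_bigr => i _.
  rewrite expiX mulrCA -expiD; congr (_ * expi _).
  by rewrite /k /node /= -/dx -natr1; ring.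
- move=> lam hl; rewrite !mulf_neq0 ?expi_neq0 //.
    have := cosb _ hl; rewrite mulrA => c1.
    rewrite (_ : 0 = 0%:C%C)// (inj_eq (@complexI _)) mulf_neq0//.
      by rewrite big_ord1 mul1r gt_eqF// hat_laplace_gt0// mulr_gt0// exprn_gt0// lt0.
    by apply: x_modulus_neq0 => //; exact: mulr_gt0 (mulr_gt0 (lt0 _ hl) v0) dx0.
  by rewrite eq_complex /= oner_eq0 andbF.
- by move=> c lam l0; exact: continuous_tensor_norm.
- by move=> c lam l0; rewrite bE (grid c lam l0).1.
Qed.

(** The basis consists of the interior hats on the first inner grid column. The surface hat is left
    out because its half-cell integral does not fit the geometric progression, hence [Nz - 1]
    functions. *)
Lemma positive_subspace_z (R : realType) (L T rho g v Lambda : R) (Nx Nz : nat) :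
  0 < L -> 0 < T -> 0 < rho -> 0 < g -> 0 < v -> 1 < Lambda -> (2 <= Nx)%N -> (1 <= Nz)%N ->
  positive_subspace (Vh L T Nx Nz) Nz.-1 (R_integral L T rho g Lambda v) /\
  exists delta : R, 0 < delta /\ forall (K : nat) (lam w : nat -> R),
    (1 <= K)%N -> quadrature_nodes Lambda K lam -> max_stepsize Lambda K lam < delta ->
    (forall j : nat, (1 <= j <= K)%N -> 0 < w j) ->
    positive_subspace (Vh L T Nx Nz) Nz.-1 (R_quadrature L T rho g K lam w v).
Proof.
move=> L0 T0 rho0 g0 v0 L1 Nx2 Nz1.
have Nx0 : (0 < Nx)%N by lia.
pose dx := deltax L Nx; pose dz := deltaz T Nz.
have dx0 : 0 < dx by rewrite divr_gt0// ltr0n.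
have dz0 : 0 < dz by rewrite divr_gt0// ltr0n.
have [beta [bL cosb _]] := exists_phase_window (mulr_gt0 v0 dx0) L1.
have lt0 lam : 1 < lam < beta -> 0 < lam by move=> /andP[/(lt_trans ltr01)].
pose k (i : 'I_1) := 1%N; pose l (j : 'I_Nz.-1) := j.+1.
have hl j : (l j < Nz)%N by rewrite /l; have := ltn_ord j; lia.
pose b (j : 'I_Nz.-1) : plane_fun R := hat L T Nx Nz (node L T Nx Nz 1 (l j)).
pose xc i := (node L T Nx Nz (k i) 0).1.
pose zc j := (node L T Nx Nz 0 (l j)).2.
have bE (c : 'I_Nz.-1 -> R) : \sum_i c i *: b i = (fun q =>
    (\sum_(i < 1) 1 * phihat ((q.1 - xc i) / dx)) *
    (\sum_j c j * phihat ((q.2 - zc j) / dz)) * \1_(Omega L T) q) :> plane_fun R.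
  apply/funext => q; rewrite fct_sumE big_ord1 mul1r mulr_sumr mulr_suml.
  apply: eq_bigr => j _; have -> : (c j *: b j) q = c j * b j q by [].
  by rewrite /b /hat [in RHS]mulrCA !mulrA.
have grid c lam (l0 : 0 < lam) := @Tf_grid R L T v lam Nx Nz _ _ (fun=> 1) k c l
  L0 T0 v0 l0 Nx0 Nz1 (fun=> Nx2) hl.
pose q lam := expR (- (lam ^+ 2 * v * dz)).
pose P lam := hat_laplace (lam ^+ 2 * v) dz dz *
  (2 * (1 - cos (lam * v * dx)) / (lam * v * dx)).
(* Moving a full hat down by [j] cells multiplies its Laplace integral by [q lam ^+ j]. *)
have laplaceX lam j : hat_laplace (lam ^+ 2 * v) dz (zc j) =
    hat_laplace (lam ^+ 2 * v) dz dz * q lam ^+ j.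
  rewrite /hat_laplace /zc /node /= -/dz mulf_eq0 pnatr_eq0 (gt_eqF dz0)/=.
  rewrite (_ : - (_ * (j.+1%:R * dz)) = j.+1%:R * - (lam ^+ 2 * v * dz)); last by ring.
  by rewrite expRM_natl exprS -/(q lam); ring.
have modE c lam : tensor_modulus v dx dz c zc lam = P lam * \sum_j c j * q lam ^+ j.
  rewrite /tensor_modulus /P [RHS]mulrAC; congr (_ * _); rewrite mulr_sumr.
  by apply: eq_bigr => j _; rewrite laplaceX; ring.
apply: (@positive_subspace_of_basis R L T rho g v Lambda beta Nz.-1 _ _ b
  (fun lam => (P lam)%:C%C * 'i%C * expi (- (lam * v * xc ord0)))
  (fun lam => (q lam)%:C%C)
  (fun c => tensor_norm v dx dz (fun=> 1) xc c zc)) => //.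
- apply: linear_span_subset => _ [j _ <-]; exists 1%N, (l j); split=> //.
  by left; split; rewrite ?Nx2 ?hl.
- move=> c lam l0; rewrite bE (grid c lam l0).2 big_ord1 mul1r modE.
  rewrite rmorphM rmorph_sum /= -!mulrA; congr (_ * _).
  rewrite mulrC -!mulrA; congr (_ * (_ * _)).
  by apply: eq_bigr => j _; rewrite rmorphM rmorphXn.
- move=> lam hl'; rewrite !mulf_neq0 ?expi_neq0 //.
    have := cosb _ hl'; rewrite mulrA => c1.
    rewrite (_ : 0 = 0%:C%C)// (inj_eq (@complexI _)) mulf_neq0//.
      by rewrite gt_eqF// hat_laplace_gt0// mulr_gt0// exprn_gt0// lt0.
    by apply: x_modulus_neq0 => //; exact: mulr_gt0 (mulr_gt0 (lt0 _ hl') v0) dx0.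
  by rewrite eq_complex /= oner_eq0 andbF.
(* Injectivity of [q] comes from that of the real exponential and of squaring on positive
   numbers. *)
- move=> lam mu hl' hm' [] /expR_inj /oppr_inj.
  move=> /(mulIf (lt0r_neq0 dz0)) /(mulIf (lt0r_neq0 v0)) /eqP.
  by rewrite eqrXn2 ?ltW ?lt0// => /eqP.
- by move=> c lam l0; exact: continuous_tensor_norm.
- by move=> c lam l0; rewrite bE (grid c lam l0).1.
Qed.

Unset Implicit Arguments.

Theorem corollary5p3 (R : realType) (L T rho g v Lambda : R) (Nx Nz : nat)
    (hL : 0 < L) (hT : 0 < T) (hrho : 0 < rho) (hg : 0 < g) (hv : 0 < v)
    (hLambda : 1 < Lambda) (hNx : (2 <= Nx)%N) (hNz : (1 <= Nz)%N) :
  (exists (Wh : set (plane_fun R)) (d : nat),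
     [/\ linear_subspace Wh,
         Wh `<=` Vh L T Nx Nz,
         has_dimension Wh d,
         (maxn Nx Nz - 1 <= d)%N &
         forall f : plane_fun R, Wh f -> f <> 0 ->
           0 < R_integral L T rho g Lambda v f])
  /\
  (exists delta : R, 0 < delta /\
     forall (K : nat) (lam w : nat -> R),
       (1 <= K)%N ->
       quadrature_nodes Lambda K lam ->
       max_stepsize Lambda K lam < delta ->
       (forall j : nat, (1 <= j <= K)%N -> 0 < w j) ->
       exists (Wh : set (plane_fun R)) (d : nat),
         [/\ linear_subspace Wh,
             Wh `<=` Vh L T Nx Nz,
             has_dimension Wh d,
             (maxn Nx Nz - 1 <= d)%N &
             forall f : plane_fun R, Wh f -> f <> 0 ->
               0 < R_quadrature L T rho g K lam w v f]).
Proof.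
(* The maximum of [Nx] and [Nz] decides which direction of grid line supplies the subspace. *)
have [NxNz|/ltnW NzNx] := leqP Nx Nz; rewrite subn1.
  exact: positive_subspace_z.
exact: positive_subspace_x.
Qed.
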